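(* The complete ternary tree with $n$ nodes has a 1-2 drawing in $O(n^{1.149})$ area.
   Context: $T_h$ denotes the complete ternary tree: every non-leaf node has exactly three children and every root-to-leaf path has exactly $h$ nodes; it has $n=(3^h-1)/2$ nodes. A drawing means a planar straight-line orthogonal grid drawing: nodes at distinct integer points, each edge a horizontal or vertical segment, no crossings; width (height) is the number of vertical (horizontal) grid lines intersecting it, area is width times height. 1-2 drawings of $T_h$ are defined recursively: for $h=1$, a single node at a grid point. For $h\ge2$, take any three (not necessarily congruent) 1-2 drawings $\Gamma^a,\Gamma^b,\Gamma^c$ of $T_{h-1}$ and combine them by Construction 1 or Construction 2; the result is a 1-2 drawing of $T_h$. Construction 1: place the root $r$ of $T_h$ at a grid point; translate $\Gamma^a$ so that its topmost grid row is one unit below $r$ and its root is on the vertical line through $r$; rotate $\Gamma^b$ clockwise by $90^\circ$ and place it so its rightmost grid column is one unit left of the leftmost column of $\Gamma^a$, its root on the horizontal line through $r$; rotate $\Gamma^c$ counterclockwise by $90^\circ$ and place it so its leftmost column is one unit right of the rightmost column of $\Gamma^a$, its root on the horizontal line through $r$; connect $r$ to the three roots. Construction 2: place $r$; rotate $\Gamma^b$ clockwise by $90^\circ$ and place it so its rightmost column is one unit left of $r$, its root on the horizontal line through $r$; rotate $\Gamma^c$ counterclockwise by $90^\circ$ and place it so its leftmost column is one unit right of $r$, its root on the horizontal line through $r$; place $\Gamma^a$ so its topmost row is one unit below the lowest row intersecting $\Gamma^b$ or $\Gamma^c$, its root on the vertical line through $r$; connect $r$ to the three roots. *)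

(* Defs.v *)
From mathcomp Require Import all_boot all_order all_algebra.

Set Implicit Arguments.
Unset Strict Implicit.
Unset Printing Implicit Defensive.

Import Order.TTheory GRing.Theory Num.Theory.
Local Open Scope ring_scope.

(* A node of a complete ternary tree is the path of child indices leading to
   it from the root: the root is [::], the children of u are rcons u i, and
   the nodes of the subtree rooted at the child i of the root are the i :: u. *)
Definition node := seq 'I_3.

Fixpoint nodes (h : nat) : seq node :=
  if h is h'.+1
  then [::] :: [seq i :: u | i <- enum 'I_3, u <- nodes h'] else [::].

Definition edges (h : nat) : seq (node * node) :=
  [seq (u, rcons u i) | u <- nodes h.-1, i <- enum 'I_3].

Lemma mem_nodes h (u : node) : (u \in nodes h) = (size u < h)%N.
Proof.
elim: h u => [|h IH] [|i u] //=; rewrite inE /= ltnS -IH.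
apply/allpairsP/idP => [[[j v] [_ /= v_h [_ ->]]] // | u_h].
by exists (i, u); split; rewrite ?mem_enum.
Qed.

Lemma nodes_uniq h : uniq (nodes h).
Proof.
elim: h => //= h IH; apply/andP; split; first by apply/allpairsP => -[[i u] []].
by apply: allpairs_uniq; rewrite ?enum_uniq // => -[i u] [j v] _ _ [-> ->].
Qed.

Lemma size_nodes h : size (nodes h) = ((3 ^ h - 1) %/ 2)%N.
Proof.
suff E : (size (nodes h) * 2 + 1 = 3 ^ h)%N by rewrite -E addnK mulnK.
elim: h => //= h IH.
by rewrite size_allpairs size_enum_ord expnS -IH mulSn mulnDr muln1 mulnA -addnA addnC -addnA.
Qed.

(* The y-axis points upwards. *)
Definition point : Type := (int * int)%type.

(* The edges being straight-line segments, a drawing of T_h is determined by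
   the positions of its nodes; the values outside nodes h are irrelevant. *)
Definition drawing := node -> point.

(* p is a point of the segment [a, b] of the plane R^2 *)
Definition on_segment (R : realFieldType) (p : R * R) (a b : point) : Prop :=
  exists2 t : R, 0 <= t <= 1 &
    p = ((1 - t) * a.1%:~R + t * b.1%:~R, (1 - t) * a.2%:~R + t * b.2%:~R).

Record planar_orthogonal (R : realFieldType) (h : nat) (G : drawing) : Prop := {
  nodes_distinct : {in nodes h &, injective G};
  edges_orthogonal : forall e, e \in edges h ->
    (G e.1).1 = (G e.2).1 \/ (G e.1).2 = (G e.2).2;
  edges_noncrossing : forall e f, e \in edges h -> f \in edges h -> e <> f ->
    forall p : R * R,
      on_segment p (G e.1) (G e.2) -> on_segment p (G f.1) (G f.2) ->
      exists u : node, [/\ u = e.1 \/ u = e.2, u = f.1 \/ u = f.2 &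
                           p = ((G u).1%:~R, (G u).2%:~R)] }.

(* the integers between a and b, in whatever order a and b are *)
Definition span (a b : int) : seq int :=
  [seq Num.min a b + k%:Z | k <- iota 0 `|b - a|%N.+1].

(* the abscissas of the vertical grid lines intersecting the drawing, and the
   ordinates of the horizontal ones, without repetition *)
Definition columns (h : nat) (G : drawing) : seq int :=
  undup ([seq (G u).1 | u <- nodes h] ++
         flatten [seq span (G e.1).1 (G e.2).1 | e <- edges h]).

Definition rows (h : nat) (G : drawing) : seq int :=
  undup ([seq (G u).2 | u <- nodes h] ++
         flatten [seq span (G e.1).2 (G e.2).2 | e <- edges h]).

Definition width (h : nat) (G : drawing) : nat := size (columns h G).
Definition height (h : nat) (G : drawing) : nat := size (rows h G).
Definition area (h : nat) (G : drawing) : nat := (width h G * height h G)%N.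

(* For 0 < h the root lies in the drawing, so that its coordinates are neutral
   as default values below. *)
Definition leftmost (h : nat) (G : drawing) : int :=
  \big[Num.min/(G [::]).1]_(x <- columns h G) x.
Definition rightmost (h : nat) (G : drawing) : int :=
  \big[Num.max/(G [::]).1]_(x <- columns h G) x.
Definition lowest (h : nat) (G : drawing) : int :=
  \big[Num.min/(G [::]).2]_(y <- rows h G) y.
Definition topmost (h : nat) (G : drawing) : int :=
  \big[Num.max/(G [::]).2]_(y <- rows h G) y.

Definition translate (v : point) (G : drawing) : drawing :=
  fun u => ((G u).1 + v.1, (G u).2 + v.2).
Definition rotate_cw (G : drawing) : drawing := fun u => ((G u).2, - (G u).1).
Definition rotate_ccw (G : drawing) : drawing := fun u => (- (G u).2, (G u).1).

(* The three subtrees of the root of T_h are isomorphic, so it is immaterial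
   which of its children is the root of which subdrawing. *)
Definition join (r : point) (A B C : drawing) : drawing := fun u =>
  match u with
  | [::] => r
  | i :: v => match val i with 0%N => A v | 1%N => B v | _ => C v end
  end.

(* In both predicates A, B, C are the final positions of the three drawings of
   T_h and r is the root of the resulting drawing of T_(h+1). *)
Record construction1 (h : nat) (r : point) (A B C : drawing) : Prop := {
  c1_A_root : (A [::]).1 = r.1;
  c1_A_top : topmost h A = r.2 - 1;
  c1_B_root : (B [::]).2 = r.2;
  c1_B_right : rightmost h B = leftmost h A - 1;
  c1_C_root : (C [::]).2 = r.2;
  c1_C_left : leftmost h C = rightmost h A + 1 }.

Record construction2 (h : nat) (r : point) (A B C : drawing) : Prop := {
  c2_B_root : (B [::]).2 = r.2;
  c2_B_right : rightmost h B = r.1 - 1;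
  c2_C_root : (C [::]).2 = r.2;
  c2_C_left : leftmost h C = r.1 + 1;
  c2_A_root : (A [::]).1 = r.1;
  c2_A_top : topmost h A = Num.min (lowest h B) (lowest h C) - 1 }.

Inductive constructible12 : nat -> drawing -> Prop :=
| constructible12_leaf (G : drawing) : constructible12 1 G
| constructible12_step (h : nat) (Ga Gb Gc : drawing) (r va vb vc : point) :
    constructible12 h Ga -> constructible12 h Gb -> constructible12 h Gc ->
    let A := translate va Ga in
    let B := translate vb (rotate_cw Gb) in
    let C := translate vc (rotate_ccw Gc) in
    construction1 h r A B C \/ construction2 h r A B C ->
    constructible12 h.+1 (join r A B C).

Definition drawing12 (R : realFieldType) (h : nat) (G : drawing) : Prop :=
  planar_orthogonal R h G /\ constructible12 h G.

(* Main.v *)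
(* The height and the half-width (the larger of the distances from the root
   column to the two sides) of a drawing obey a recursion. If the side
   subdrawings have half-width w and height k and the middle one has half-width
   w' and height k', Construction 1 yields half-width w' + k and height
   max(k', w) + w + 1, and Construction 2 yields half-width max(w', k) and
   height k' + 2w + 1. Consider three families of drawings, where C1(Y, X, X)
   stands for Construction 1 with middle subdrawing Y and both side subdrawings X:
     X' = C2(Z, X, X),  Y' = C1(X, X, X),  Z' = C1(Y, X, X).
   Their dimensions grow at most by the factor a at each level as soon as
   a^3 >= a^2 + a + 1 (the optimal a is the tribonacci constant 1.839...), so
   that the area of X is O(a^(2h)). For a = 13/7 one has a^14 <= 3^8, hence an
   area O(n^(8/7)), and 8/7 < 1.149. *)
Require Import Defs.
From mathcomp Require Import all_boot all_order all_algebra.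
From mathcomp Require Import reals exp.
From mathcomp Require Import ring lra zify.

Set Implicit Arguments.
Unset Strict Implicit.
Unset Printing Implicit Defensive.

Import Order.TTheory GRing.Theory Num.Theory.
Local Open Scope ring_scope.

(** * Extents of a drawing *)

Lemma mem_edges h u v :
  reflect (exists2 i, (size u < h.-1)%N & v = rcons u i) ((u, v) \in edges h).
Proof.
apply: (iffP allpairsP) => [[[w i] [/= w_h _ [-> ->]]] | [i u_h ->]].
  by exists i; rewrite -?mem_nodes.
by exists (u, i); rewrite mem_nodes mem_enum.
Qed.

Lemma edge_nodes h e : e \in edges h -> (e.1 \in nodes h) && (e.2 \in nodes h).
Proof.
case: e => u v /mem_edges[i u_h ->] /=; rewrite !mem_nodes size_rcons.
by case: h u_h => // h; rewrite /= ltnS => u_h; rewrite ltnW.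
Qed.

Lemma mem_span a b x : x \in Defs.span a b -> Num.min a b <= x <= Num.max a b.
Proof.
by case/mapP => k; rewrite mem_iota add0n => /andP[_ k_ab] ->; lia.
Qed.

(** [columns] and [rows] are, by conversion, the instances at the abscissa and the ordinate. With
    [cmin] and [cmax], each fact about the four extremes is thus proved once per direction of the
    order. *)
Definition coords (h : nat) (f : node -> int) : seq int :=
  undup ([seq f u | u <- nodes h] ++
         flatten [seq Defs.span (f e.1) (f e.2) | e <- edges h]).

Definition cmin h f := \big[Num.min/f [::]]_(x <- coords h f) x.
Definition cmax h f := \big[Num.max/f [::]]_(x <- coords h f) x.

Lemma node_coords h f u : u \in nodes h -> f u \in coords h f.
Proof. by move=> u_h; rewrite mem_undup mem_cat map_f. Qed.

(** An edge spans only values between those at its two ends, so nodes alone determine the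
    extremes. *)
Lemma coords_between h f x : x \in coords h f ->
  exists u v, [/\ u \in nodes h, v \in nodes h & f u <= x <= f v].
Proof.
rewrite mem_undup mem_cat => /orP[/mapP[u u_h ->] | /flatten_mapP[e e_h]].
  by exists u, u; split=> //; lia.
have /andP[e1 e2] := edge_nodes e_h.
by move=> /mem_span; case: (leP (f e.1)) => _ x_e; [exists e.1, e.2 | exists e.2, e.1].
Qed.

(** [min] and [max] on [int] have no neutral element, so the fold may also return its starting
    value. *)
Lemma big_selective_mem (T : eqType) (op : T -> T -> T) (x0 : T) (s : seq T) :
  (forall x y, op x y = x \/ op x y = y) -> \big[op/x0]_(x <- s) x \in x0 :: s.
Proof.
move=> op_sel; elim: s => [|x s IH]; first by rewrite big_nil mem_head.
rewrite big_cons; case: (op_sel x (\big[op/x0]_(y <- s) y)) => ->.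
  by rewrite !inE eqxx orbT.
by move: IH; rewrite !inE => /orP[->|->] //; rewrite !orbT.
Qed.

Lemma cminP h f : (0 < h)%N ->
  (forall u, u \in nodes h -> cmin h f <= f u) /\
  exists2 u, u \in nodes h & f u = cmin h f.
Proof.
move=> h_gt0; have le_min u : u \in nodes h -> cmin h f <= f u.
  by move=> /(node_coords f) fu; exact: (@ge_bigmin_seq _ _ _ _ _ _ xpredT id fu).
split=> //; have root_h : [::] \in nodes h by rewrite mem_nodes.
(* The starting value is harmless: it is the value at the root, which is a node since [0 < h]. *)
have : cmin h f \in f [::] :: coords h f.
  by apply: big_selective_mem => x y; lia.
rewrite inE => /orP[/eqP E|/coords_between[u [_ [u_h _ /andP[le_u _]]]]].
  by exists [::].
by exists u => //; apply: le_anti; rewrite le_u le_min.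
Qed.

Lemma cmaxP h f : (0 < h)%N ->
  (forall u, u \in nodes h -> f u <= cmax h f) /\
  exists2 u, u \in nodes h & f u = cmax h f.
Proof.
move=> h_gt0; have le_max u : u \in nodes h -> f u <= cmax h f.
  by move=> /(node_coords f) fu; exact: (@le_bigmax_seq _ _ _ _ _ _ xpredT id fu).
split=> //; have root_h : [::] \in nodes h by rewrite mem_nodes.
have : cmax h f \in f [::] :: coords h f.
  by apply: big_selective_mem => x y; lia.
rewrite inE => /orP[/eqP E|/coords_between[_ [u [_ u_h /andP[_ ge_u]]]]].
  by exists [::].
by exists u => //; apply: le_anti; rewrite ge_u le_max.
Qed.

Lemma cmin_shift h f c : (0 < h)%N ->
  cmin h (fun u => f u + c) = cmin h f + c.
Proof.
move=> h_gt0; have [le_f [u u_h fu]] := cminP f h_gt0.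
have [le_fc [v v_h fv]] := cminP (fun u => f u + c) h_gt0.
by move: (le_f v v_h) (le_fc u u_h) fu fv => /=; lia.
Qed.

Lemma cmax_shift h f c : (0 < h)%N ->
  cmax h (fun u => f u + c) = cmax h f + c.
Proof.
move=> h_gt0; have [le_f [u u_h fu]] := cmaxP f h_gt0.
have [le_fc [v v_h fv]] := cmaxP (fun u => f u + c) h_gt0.
by move: (le_f v v_h) (le_fc u u_h) fu fv => /=; lia.
Qed.

(** All values lie in the window of [k] consecutive integers that starts at the minimum, attained at
    the node [w]. *)
Lemma size_coords h f (k : nat) : (0 < h)%N ->
  (forall u v, u \in nodes h -> v \in nodes h -> f u - f v < k%:Z) ->
  (size (coords h f) <= k)%N.
Proof.
move=> h_gt0 f_k; have [_ [w w_h fw]] := cminP f h_gt0.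
rewrite -[leqRHS](size_iota 0) -(size_map (fun i : nat => f w + i%:Z)).
apply: uniq_leq_size; first exact: undup_uniq.
move=> x x_f; have [u [v [u_h v_h x_uv]]] := coords_between x_f.
have le_wx : f w <= x.
  by rewrite fw; exact: (@ge_bigmin_seq _ _ _ _ _ _ xpredT id x_f).
have vw := f_k v w v_h w_h; apply/mapP; exists `|x - f w|%N; last by lia.
by rewrite mem_iota; lia.
Qed.

(** * Planarity of 1-2 drawings *)

Definition pt (R : realFieldType) (a : point) : R * R := (a.1%:~R, a.2%:~R).

Lemma pt_inj R : injective (pt R).
Proof. by move=> [a b] [c d] [/intr_inj/= -> /intr_inj/= ->]. Qed.

Lemma on_segment_left (R : realFieldType) a b : on_segment (pt R a) a b.
Proof.
exists 0; first by rewrite lexx ler01.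
by rewrite subr0 !mul1r !mul0r !addr0.
Qed.

(** Half-planes are convex. The four sides of a bounding box are obtained from coefficients 0, 1 and
    -1. *)
Lemma on_segment_halfplane (R : realFieldType) (x y c : R) p a b :
  on_segment p a b -> x * a.1%:~R + y * a.2%:~R <= c ->
  x * b.1%:~R + y * b.2%:~R <= c -> x * p.1 + y * p.2 <= c.
Proof. by case=> t /andP[t0 t1] -> /= ac bc; nra. Qed.

Lemma on_segment_box (R : realFieldType) (p : R * R) (a b : point) l r d u :
  on_segment p a b ->
  l <= a.1 <= r -> l <= b.1 <= r -> d <= a.2 <= u -> d <= b.2 <= u ->
  [/\ l%:~R <= p.1, p.1 <= r%:~R, d%:~R <= p.2 & p.2 <= u%:~R].
Proof.
move=> p_ab; rewrite -!(ler_int R).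
move=> /andP[la ra] /andP[lb rb] /andP[da ua] /andP[db ub].
have H := on_segment_halfplane p_ab.
have H1 : -1 * p.1 + 0 * p.2 <= - l%:~R by apply: H; lra.
have H2 : 1 * p.1 + 0 * p.2 <= r%:~R by apply: H; lra.
have H3 : 0 * p.1 + -1 * p.2 <= - d%:~R by apply: H; lra.
have H4 : 0 * p.1 + 1 * p.2 <= u%:~R by apply: H; lra.
by split; lra.
Qed.

(** Here [f] moves the integer points and [g] undoes that motion on the real plane: a common point
    of two moved edges is pulled back by [g], recognized there as a node, and pushed forward
    again. *)
Lemma planar_transform (R : realFieldType) h G (f : point -> point) (g : R * R -> R * R) :
  (forall p a b, on_segment p (f a) (f b) -> on_segment (g p) a b) ->
  (forall p a, g p = pt R a -> p = pt R (f a)) -> injective f ->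
  (forall a b : point, a.1 = b.1 \/ a.2 = b.2 ->
     (f a).1 = (f b).1 \/ (f a).2 = (f b).2) ->
  planar_orthogonal R h G -> planar_orthogonal R h (fun u => f (G u)).
Proof.
move=> seg_f pt_f f_inj orth_f [G_inj G_orth G_cross]; constructor.
- by move=> u v u_h v_h /f_inj; apply: G_inj.
- by move=> e e_h; apply/orth_f/G_orth.
move=> e e' e_h e'_h ne p /seg_f p_e /seg_f p_e'.
have [u [u_e u_e' E]] := G_cross e e' e_h e'_h ne _ p_e p_e'.
by exists u; split=> //; apply: pt_f.
Qed.

Lemma on_segment_translate (R : realFieldType) (p : R * R) v a b :
  on_segment p (a.1 + v.1, a.2 + v.2) (b.1 + v.1, b.2 + v.2) ->
  on_segment (p.1 - v.1%:~R, p.2 - v.2%:~R) a b.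
Proof.
case=> t t01 -> /=; exists t => //.
by congr (_, _); rewrite !intrD; lra.
Qed.

Lemma on_segment_cw (R : realFieldType) (p : R * R) (a b : point) :
  on_segment p (a.2, - a.1) (b.2, - b.1) -> on_segment (- p.2, p.1) a b.
Proof.
case=> t t01 -> /=; exists t => //.
by congr (_, _); rewrite !intrN; lra.
Qed.

Lemma on_segment_ccw (R : realFieldType) (p : R * R) (a b : point) :
  on_segment p (- a.2, a.1) (- b.2, b.1) -> on_segment (p.2, - p.1) a b.
Proof.
case=> t t01 -> /=; exists t => //.
by congr (_, _); rewrite !intrN; lra.
Qed.

Lemma planar_translate R h v G :
  planar_orthogonal R h G -> planar_orthogonal R h (translate v G).
Proof.
move=> plG; pose f (a : point) : point := (a.1 + v.1, a.2 + v.2).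
apply: (@planar_transform R h G f _ (fun p a b => @on_segment_translate R p v a b)) plG.
- move=> [x y] [a b] [/= Ex Ey]; rewrite /pt /=.
  by congr (_, _); rewrite !intrD; lra.
- by move=> [a b] [c d] [/= E1 E2]; congr (_, _); lia.
- by move=> a b /= [->|->]; [left|right].
Qed.

Lemma planar_cw R h G :
  planar_orthogonal R h G -> planar_orthogonal R h (rotate_cw G).
Proof.
apply: (@planar_transform R h G (fun a => (a.2, - a.1)) _ (@on_segment_cw R)).
- move=> [x y] [a b] [/= Ex Ey]; rewrite /pt /=.
  by congr (_, _); rewrite ?intrN; lra.
- by move=> [a b] [c d] [/= E1 E2]; congr (_, _); lia.
- by move=> a b /= [->|->]; [right|left].
Qed.

Lemma planar_ccw R h G :
  planar_orthogonal R h G -> planar_orthogonal R h (rotate_ccw G).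
Proof.
apply: (@planar_transform R h G (fun a => (- a.2, a.1)) _ (@on_segment_ccw R)).
- move=> [x y] [a b] [/= Ex Ey]; rewrite /pt /=.
  by congr (_, _); rewrite ?intrN; lra.
- by move=> [a b] [c d] [/= E1 E2]; congr (_, _); lia.
- by move=> a b /= [->|->]; [right|left].
Qed.

(** If [e] does not start at the root, it is compared with the edge from the root to its first
    child: both contain the root point, so planarity makes that point a shared node, which by
    injectivity is the root. *)
Lemma root_on_edge R h G e : planar_orthogonal R h G -> e \in edges h ->
  on_segment (pt R (G [::])) (G e.1) (G e.2) -> e.1 = [::] \/ e.2 = [::].
Proof.
move=> [G_inj _ G_cross] e_h p_e; case: (eqVneq e.1 [::]) => [|e1]; first by left.
have f_h : (([::], [:: ord0]) : node * node) \in edges h.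
  case: e e_h {e1 p_e} => u v /mem_edges[i u_h _].
  by apply/mem_edges; exists ord0 => //; apply: leq_trans u_h.
have ne : e <> ([::], [:: ord0]) by move=> E; rewrite E in e1.
have [u [u_e _ E]] := G_cross _ _ e_h f_h ne _ p_e (on_segment_left R _ _).
have /andP[e1_h e2_h] := edge_nodes e_h; have /andP[root_h _] := edge_nodes f_h.
have u0 : [::] = u.
  by apply: G_inj (pt_inj E) => //; case: u_e => ->.
by rewrite u0; case: u_e => ->; [left|right].
Qed.

(** * Planarity of a tree joined from three subdrawings *)

Lemma edgesS h e : e \in edges h.+1 ->
  (exists i, e = ([::], [:: i])) \/
  exists i u v, (u, v) \in edges h /\ e = (i :: u, i :: v).
Proof.
case: e => [[|i u] w] /mem_edges[j /= u_h ->]; first by left; exists j.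
right; exists i, u, (rcons u j); split=> //.
by apply/mem_edges; exists j => //; case: h u_h.
Qed.

(* [K i] is meant as a region containing the subdrawing of the child [i] and the
   edge joining it to the root, minus the root. *)
Lemma planar_join (R : realFieldType) h G (K : 'I_3 -> R * R -> Prop) :
  (forall i, planar_orthogonal R h (fun u => G (i :: u))) ->
  (forall i, (G [::]).1 = (G [:: i]).1 \/ (G [::]).2 = (G [:: i]).2) ->
  (forall i u, u \in nodes h -> K i (pt R (G (i :: u)))) ->
  (forall i u v p, (u, v) \in edges h ->
     on_segment p (G (i :: u)) (G (i :: v)) -> K i p) ->
  (forall i p, on_segment p (G [::]) (G [:: i]) -> p = pt R (G [::]) \/ K i p) ->
  (forall i, ~ K i (pt R (G [::]))) ->
  (forall i j p, K i p -> K j p -> i = j) ->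
  (forall i u v p, (u, v) \in edges h -> on_segment p (G (i :: u)) (G (i :: v)) ->
     on_segment p (G [::]) (G [:: i]) -> p = pt R (G [:: i])) ->
  planar_orthogonal R h.+1 G.
Proof.
move=> plG orthG K_node K_edge K_stem K_root K_disj stem_end.
have node_sub i u : i :: u \in nodes h.+1 -> u \in nodes h.
  by rewrite !mem_nodes.
(* A stem joins the root to a child. If it meets an edge of a subdrawing, disjointness of the
   regions forces [i = j]; the common point is then the root of that subdrawing, hence an end of the
   edge by [root_on_edge]. *)
have stem_sub i j u v p : (u, v) \in edges h ->
    on_segment p (G [::]) (G [:: i]) -> on_segment p (G (j :: u)) (G (j :: v)) ->
    exists w : node, [/\ w = [::] \/ w = [:: i], w = j :: u \/ w = j :: v &
                         p = pt R (G w)].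
  move=> uv p_stem p_uv; have Kj := K_edge _ _ _ _ uv p_uv.
  have Ki : K i p.
    case: (K_stem _ _ p_stem) => // E; rewrite E in Kj.
    by case: (K_root _ Kj).
  have E := K_disj _ _ _ Ki Kj; rewrite -{j Kj}E in p_uv *.
  have Ep := stem_end _ _ _ _ uv p_uv p_stem; rewrite Ep in p_uv.
  have /= end_uv := root_on_edge (plG i) uv p_uv.
  by exists [:: i]; split; [right | case: end_uv => ->; [left|right] | ].
constructor.
- move=> [|i u] [|j v] // u_h v_h E.
  + by case: (K_root j); rewrite E; exact: K_node (node_sub _ _ v_h).
  + by case: (K_root i); rewrite -E; exact: K_node (node_sub _ _ u_h).
  have Ku := K_node i u (node_sub i u u_h); have Kv := K_node j v (node_sub j v v_h).
  rewrite -E in Kv; have ij := K_disj _ _ _ Ku Kv; rewrite -{j Kv}ij in v_h E *.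
  congr (_ :: _); apply: (nodes_distinct (plG i)) E.
  + exact: node_sub u_h.
  + exact: node_sub v_h.
- move=> e /edgesS[[i ->]|[i [u [v [uv ->]]]]] /=; first exact: orthG.
  exact: (edges_orthogonal (plG i) uv).
move=> e f /edgesS[[i ->]|[i [u [v [uv ->]]]]] /edgesS[[j ->]|[j [u' [v' [uv' ->]]]]]
  ne p /= p_e p_f.
- exists [::]; split; [by left | by left | ].
  have [//|Ki] := K_stem _ _ p_e; have [//|Kj] := K_stem _ _ p_f.
  by case: ne; rewrite (K_disj _ _ _ Ki Kj).
- exact: stem_sub p_e p_f.
- by have [w [w_f w_e E]] := stem_sub _ _ _ _ _ uv p_f p_e; exists w.
have E := K_disj _ _ _ (K_edge _ _ _ _ uv p_e) (K_edge _ _ _ _ uv' p_f).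
rewrite -{j}E in ne p_f *; have ne' : (u, v) <> (u', v').
  by move=> [Eu Ev]; case: ne; rewrite Eu Ev.
have [w [w_e w_f Ep]] := edges_noncrossing (plG i) uv uv' ne' p_e p_f.
exists (i :: w); split=> //; first by case: w_e => ->; [left|right].
by case: w_f => ->; [left|right].
Qed.

Lemma node_box h D u : (0 < h)%N -> u \in nodes h ->
  (leftmost h D <= (D u).1 <= rightmost h D) &&
  (lowest h D <= (D u).2 <= topmost h D).
Proof.
move=> h_gt0 u_h.
have [l _] := cminP (fun u => (D u).1) h_gt0; have [r _] := cmaxP (fun u => (D u).1) h_gt0.
have [b _] := cminP (fun u => (D u).2) h_gt0; have [t _] := cmaxP (fun u => (D u).2) h_gt0.
by rewrite (l u) // (r u) // (b u) // (t u).
Qed.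

Definition in_box (R : realFieldType) h D (p : R * R) : Prop :=
  [/\ (leftmost h D)%:~R <= p.1, p.1 <= (rightmost h D)%:~R,
      (lowest h D)%:~R <= p.2 & p.2 <= (topmost h D)%:~R].

Lemma in_box_node (R : realFieldType) h D u : (0 < h)%N ->
  u \in nodes h -> in_box h D (pt R (D u)).
Proof.
move=> h_gt0 /(node_box D h_gt0) /andP[/andP[l r] /andP[b t]].
by split; rewrite /= ler_int.
Qed.

Lemma in_box_edge (R : realFieldType) h D e (p : R * R) : (0 < h)%N ->
  e \in edges h -> on_segment p (D e.1) (D e.2) -> in_box h D p.
Proof.
move=> h_gt0 /edge_nodes/andP[u_h v_h] p_uv.
have /andP[u1 u2] := node_box D h_gt0 u_h; have /andP[v1 v2] := node_box D h_gt0 v_h.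
exact: on_segment_box p_uv u1 v1 u2 v2.
Qed.

(** This lets a stem reach the root from above without meeting the drawing earlier. The clockwise
    quarter turn changes it into [clear_right], the counterclockwise one into [clear_left]. *)
Definition clear_above (R : realFieldType) h G := forall e (p : R * R),
  e \in edges h -> on_segment p (G e.1) (G e.2) ->
  p.1 = (G [::]).1%:~R -> p.2 <= (G [::]).2%:~R.

Definition clear_right (R : realFieldType) h G := forall e (p : R * R),
  e \in edges h -> on_segment p (G e.1) (G e.2) ->
  p.2 = (G [::]).2%:~R -> p.1 <= (G [::]).1%:~R.

Definition clear_left (R : realFieldType) h G := forall e (p : R * R),
  e \in edges h -> on_segment p (G e.1) (G e.2) ->
  p.2 = (G [::]).2%:~R -> (G [::]).1%:~R <= p.1.

(** The case analysis is that of [join], so that one rewriting of the child index reduces both. *)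
Definition by_child T (a b c : T) (i : 'I_3) : T :=
  match val i with 0%N => a | 1%N => b | _ => c end.

Lemma forall_child (P : 'I_3 -> Prop) :
  (forall i : 'I_3, i = 0%N :> nat -> P i) -> (forall i : 'I_3, i = 1%N :> nat -> P i) ->
  (forall i : 'I_3, i = 2%N :> nat -> P i) -> forall i, P i.
Proof.
move=> P0 P1 P2 i; case E: (val i) (ltn_ord i) => [|[|[|//]]] _;
  [exact: P0 | exact: P1 | exact: P2].
Qed.

(** The part common to both constructions. Each region contains the box of its subdrawing and the
    open ray from [r] along which its stem leaves. [KB] and [KC] are separated by the column of [r],
    so only [KA] has to be separated from each of them. The invariant [clear_above] is reestablished
    for the next level. *)
Lemma planar_regions (R : realFieldType) h (r : point) A B C (KA KB KC : R * R -> Prop) :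
  (0 < h)%N ->
  planar_orthogonal R h A -> planar_orthogonal R h B -> planar_orthogonal R h C ->
  clear_above R h A -> clear_right R h B -> clear_left R h C ->
  (A [::]).1 = r.1 -> (B [::]).2 = r.2 -> (C [::]).2 = r.2 ->
  topmost h A < r.2 -> rightmost h B < r.1 -> r.1 < leftmost h C ->
  (forall p, in_box h A p -> KA p) -> (forall p, in_box h B p -> KB p) ->
  (forall p, in_box h C p -> KC p) ->
  (forall p : R * R, p.1 = r.1%:~R -> p.2 < r.2%:~R -> KA p) ->
  (forall p : R * R, p.2 = r.2%:~R -> p.1 < r.1%:~R -> KB p) ->
  (forall p : R * R, p.2 = r.2%:~R -> r.1%:~R < p.1 -> KC p) ->
  (forall p, KA p -> p.2 < r.2%:~R) ->
  (forall p, KB p -> p.1 < r.1%:~R) ->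
  (forall p, KC p -> r.1%:~R < p.1) ->
  (forall p, KA p -> ~ KB p) -> (forall p, KA p -> ~ KC p) ->
  planar_orthogonal R h.+1 (join r A B C) /\ clear_above R h.+1 (join r A B C).
Proof.
move=> h_gt0 plA plB plC clA clB clC rA rB rC tA rtB lC boxA boxB boxC stA stB stC
  outA outB outC disAB disAC.
have root_h : [::] \in nodes h by rewrite mem_nodes.
have /andP[_ /andP[_ A_top]] := node_box A h_gt0 root_h.
have /andP[/andP[_ B_right] _] := node_box B h_gt0 root_h.
have /andP[/andP[C_left _] _] := node_box C h_gt0 root_h.
have A_low := le_trans A_top (ltW tA); have B_le := le_trans B_right (ltW rtB).
have C_ge := le_trans (ltW lC) C_left.
have stemA (p : R * R) : on_segment p r (A [::]) ->
    [/\ p.1 = r.1%:~R, (A [::]).2%:~R <= p.2 & p.2 <= r.2%:~R].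
  move=> p_st; have [] := @on_segment_box R p _ _ r.1 r.1 (A [::]).2 r.2 p_st;
    rewrite ?rA ?rB ?rC ?lexx ?A_low ?B_le ?C_ge //.
  by move=> x1 x2 y1 y2; split=> //; lra.
have stemB (p : R * R) : on_segment p r (B [::]) ->
    [/\ p.2 = r.2%:~R, (B [::]).1%:~R <= p.1 & p.1 <= r.1%:~R].
  move=> p_st; have [] := @on_segment_box R p _ _ (B [::]).1 r.1 r.2 r.2 p_st;
    rewrite ?rA ?rB ?rC ?lexx ?A_low ?B_le ?C_ge //.
  by move=> x1 x2 y1 y2; split=> //; lra.
have stemC (p : R * R) : on_segment p r (C [::]) ->
    [/\ p.2 = r.2%:~R, r.1%:~R <= p.1 & p.1 <= (C [::]).1%:~R].
  move=> p_st; have [] := @on_segment_box R p _ _ r.1 (C [::]).1 r.2 r.2 p_st;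
    rewrite ?rA ?rB ?rC ?lexx ?A_low ?B_le ?C_ge //.
  by move=> x1 x2 y1 y2; split=> //; lra.
pose K := by_child KA KB KC.
have K_edge : forall i u v (p : R * R), (u, v) \in edges h ->
    on_segment p (join r A B C (i :: u)) (join r A B C (i :: v)) -> K i p.
  apply: forall_child => i Ei u v p uv; rewrite /K /by_child /= Ei => p_uv.
  - exact/boxA/(in_box_edge h_gt0 uv).
  - exact/boxB/(in_box_edge h_gt0 uv).
  - exact/boxC/(in_box_edge h_gt0 uv).
have K_stem : forall i (p : R * R),
    on_segment p r (join r A B C [:: i]) -> p = pt R r \/ K i p.
  apply: forall_child => i Ei [x y]; rewrite /K /by_child /= Ei.
  - move=> /stemA[/= x_r _]; rewrite le_eqVlt => /orP[/eqP y_r|y_r].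
      by left; rewrite x_r y_r.
    by right; apply: stA.
  - move=> /stemB[/= y_r _]; rewrite le_eqVlt => /orP[/eqP x_r|x_r].
      by left; rewrite x_r y_r.
    by right; apply: stB.
  - move=> /stemC[/= y_r]; rewrite le_eqVlt => /orP[/eqP x_r|x_r] _.
      by left; rewrite -x_r y_r.
    by right; apply: stC.
(* This yields the new [clear_above]: the side regions miss the root column, and the middle one lies
   below the root. *)
have K_below : forall i p, K i p -> p.1 = r.1%:~R -> p.2 <= r.2%:~R.
  apply: forall_child => i Ei p; rewrite /K /by_child /= Ei => Kp Ep.
  - exact/ltW/outA.
  - by have := outB p Kp; rewrite Ep ltxx.
  - by have := outC p Kp; rewrite Ep ltxx.
split; last first.
  move=> e p /edgesS[[i ->]|[i [u [v [uv ->]]]]] /= p_e; last first.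
    exact: (K_below i p (K_edge _ _ _ _ uv p_e)).
  by case: (K_stem _ _ p_e) => [-> //|]; apply: K_below.
apply: (@planar_join R h (join r A B C) K) => //.
- by apply: forall_child => i Ei /=; rewrite Ei.
- by apply: forall_child => i Ei /=; rewrite Ei; [left|right|right].
- apply: forall_child => i Ei u u_h; rewrite /K /by_child /= Ei.
  + exact/boxA/in_box_node.
  + exact/boxB/in_box_node.
  + exact/boxC/in_box_node.
- apply: forall_child => i Ei; rewrite /K /by_child /= Ei => Kr.
  + by have := outA _ Kr; rewrite ltxx.
  + by have := outB _ Kr; rewrite ltxx.
  + by have := outC _ Kr; rewrite ltxx.
- apply: forall_child => i Ei; apply: forall_child => j Ej p;
    rewrite /K /by_child /= Ei Ej => Ki Kj; try by apply: val_inj; rewrite /= Ei Ej.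
  + by case: (disAB p).
  + by case: (disAC p).
  + by case: (disAB p).
  + by have := lt_trans (outB p Ki) (outC p Kj); rewrite ltxx.
  + by case: (disAC p).
  + by have := lt_trans (outB p Kj) (outC p Ki); rewrite ltxx.
(* A stem stops at the root of its subdrawing and the clearance keeps the subdrawing from going past
   that root, so the two inequalities pin down the common point. *)
apply: forall_child => i Ei u v [x y] uv; rewrite /= Ei => p_uv.
- move=> /stemA[/= x_r y_A _]; rewrite /pt; congr (_, _); first by rewrite x_r rA.
  by apply: le_anti; rewrite y_A andbT; apply: (clA _ _ uv p_uv); rewrite /= x_r rA.
- move=> /stemB[/= y_r x_B _]; rewrite /pt; congr (_, _); last by rewrite y_r rB.
  by apply: le_anti; rewrite x_B andbT; apply: (clB _ _ uv p_uv); rewrite /= y_r rB.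
- move=> /stemC[/= y_r _ x_C]; rewrite /pt; congr (_, _); last by rewrite y_r rC.
  by apply: le_anti; rewrite x_C /=; apply: (clC _ _ uv p_uv); rewrite /= y_r rC.
Qed.

Lemma construction1_planar (R : realFieldType) h r A B C : (0 < h)%N ->
  planar_orthogonal R h A -> planar_orthogonal R h B -> planar_orthogonal R h C ->
  clear_above R h A -> clear_right R h B -> clear_left R h C ->
  construction1 h r A B C ->
  planar_orthogonal R h.+1 (join r A B C) /\ clear_above R h.+1 (join r A B C).
Proof.
move=> h_gt0 plA plB plC clA clB clC [rA tA rB rtB rC lC].
have root_h : [::] \in nodes h by rewrite mem_nodes.
have /andP[/andP[lA rtA] _] := node_box A h_gt0 root_h.
have tA_lt : topmost h A < r.2 by lia.
have rtB_le : rightmost h B < leftmost h A by lia.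
have lC_ge : rightmost h A < leftmost h C by lia.
have lA_r : leftmost h A <= r.1 by rewrite -rA.
have rtA_r : r.1 <= rightmost h A by rewrite -rA.
have rtB_r := lt_le_trans rtB_le lA_r; have lC_r := le_lt_trans rtA_r lC_ge.
(* The middle region is the half-strip below [r] over the columns of [A]. Each side region is the
   rest of an open half-plane beside [r]: it has to bend over [A], since its stem runs above [A] and
   its box lies beyond it. *)
apply: (@planar_regions R h r A B C
  (fun p : R * R => [/\ p.2 < r.2%:~R,
    (leftmost h A)%:~R <= p.1 & p.1 <= (rightmost h A)%:~R])
  (fun p : R * R => p.1 < r.1%:~R /\ (r.2%:~R <= p.2 \/ p.1 < (leftmost h A)%:~R))
  (fun p : R * R => r.1%:~R < p.1 /\ (r.2%:~R <= p.2 \/ (rightmost h A)%:~R < p.1))) => //;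
  move: tA_lt rtB_le lC_ge lA_r rtA_r rtB_r lC_r;
  rewrite -!(ltr_int R) -!(ler_int R) => tA_lt rtB_le lC_ge lA_r rtA_r rtB_r lC_r p.
- by case=> *; split; lra.
- by case=> *; split; [lra | right; lra].
- by case=> *; split; [lra | right; lra].
- by move=> *; split; lra.
- by move=> *; split; [lra | left; lra].
- by move=> *; split; [lra | left; lra].
- by case.
- by case.
- by case.
- by move=> [y l _] [_ [/(lt_le_trans y)|/lt_le_trans/(_ l)]]; rewrite ltxx.
- by move=> [y _ u] [_ [/(lt_le_trans y)|/(le_lt_trans u)]]; rewrite ltxx.
Qed.

Lemma construction2_planar (R : realFieldType) h r A B C : (0 < h)%N ->
  planar_orthogonal R h A -> planar_orthogonal R h B -> planar_orthogonal R h C ->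
  clear_above R h A -> clear_right R h B -> clear_left R h C ->
  construction2 h r A B C ->
  planar_orthogonal R h.+1 (join r A B C) /\ clear_above R h.+1 (join r A B C).
Proof.
move=> h_gt0 plA plB plC clA clB clC [rB rtB rC lC rA tA].
have root_h : [::] \in nodes h by rewrite mem_nodes.
(* The root of [B] is in the row of [r], so being below [B] puts [A] below [r]. *)
have /andP[_ /andP[bB _]] := node_box B h_gt0 root_h; rewrite rB in bB.
have tAB : topmost h A < lowest h B by lia.
have tAC : topmost h A < lowest h C by lia.
have tA_lt := lt_le_trans tAB bB.
have rtB_le : rightmost h B < r.1 by lia.
have lC_ge : r.1 < leftmost h C by lia.
(* The row [topmost h A] cuts the plane: the side regions are the two quadrants above it, and the
   middle region is what lies at or below it, together with the ray going down from [r] between the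
   quadrants. *)
apply: (@planar_regions R h r A B C
  (fun p : R * R => p.2 < r.2%:~R /\ (p.1 = r.1%:~R \/ p.2 <= (topmost h A)%:~R))
  (fun p : R * R => p.1 < r.1%:~R /\ (topmost h A)%:~R < p.2)
  (fun p : R * R => r.1%:~R < p.1 /\ (topmost h A)%:~R < p.2)) => //;
  move: tAB tAC tA_lt rtB_le lC_ge;
  rewrite -!(ltr_int R) => tAB tAC tA_lt rtB_le lC_ge p.
- by case=> *; split; [lra | right; lra].
- by case=> *; split; lra.
- by case=> *; split; lra.
- by move=> *; split; [lra | left; lra].
- by move=> *; split; lra.
- by move=> *; split; lra.
- by case.
- by case.
- by case.
- by move=> [_ [->|y]] [x /lt_le_trans ty]; [rewrite ltxx in x | have := ty _ y; rewrite ltxx].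
- by move=> [_ [->|y]] [x /lt_le_trans ty]; [rewrite ltxx in x | have := ty _ y; rewrite ltxx].
Qed.

(** * Planarity by induction on the construction *)

Lemma constructible12_gt0 h G : constructible12 h G -> (0 < h)%N.
Proof. by case. Qed.

Lemma clear_above_translate (R : realFieldType) h G v :
  clear_above R h G -> clear_above R h (translate v G).
Proof.
move=> clG e p e_h /on_segment_translate p_e; rewrite /= !intrD => Ep.
by have := clG e _ e_h p_e; rewrite /=; lra.
Qed.

Lemma clear_right_cw (R : realFieldType) h G v :
  clear_above R h G -> clear_right R h (translate v (rotate_cw G)).
Proof.
move=> clG e p e_h /on_segment_translate/on_segment_cw/(clG e _ e_h) /=.
rewrite !intrD !intrN => le_p Ep.
suff : p.1 - v.1%:~R <= (G [::]).2%:~R by lra.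
by apply: le_p; rewrite Ep; lra.
Qed.

Lemma clear_left_ccw (R : realFieldType) h G v :
  clear_above R h G -> clear_left R h (translate v (rotate_ccw G)).
Proof.
move=> clG e p e_h /on_segment_translate/on_segment_ccw/(clG e _ e_h) /=.
rewrite !intrD !intrN => le_p Ep.
suff : - (p.1 - v.1%:~R) <= (G [::]).2%:~R by lra.
by apply: le_p; rewrite Ep; lra.
Qed.

(** Planarity alone is not inductive: attaching the stems requires the clearance of the three
    subdrawings. *)
Lemma constructible12_planar (R : realFieldType) h G :
  constructible12 h G -> planar_orthogonal R h G /\ clear_above R h G.
Proof.
elim=> {h G} [G | h Ga Gb Gc r va vb vc Ga12 [plA clA] _ [plB clB] _ [plC clC] A B C].
  split=> //; split=> // u v; rewrite !mem_nodes !ltnS !leqn0 !size_eq0.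
  by move=> /eqP-> /eqP->.
have h_gt0 := constructible12_gt0 Ga12.
have plA' : planar_orthogonal R h A by apply: planar_translate.
have plB' : planar_orthogonal R h B by apply/planar_translate/planar_cw.
have plC' : planar_orthogonal R h C by apply/planar_translate/planar_ccw.
have clA' : clear_above R h A by apply: clear_above_translate.
have clB' : clear_right R h B by apply: clear_right_cw.
have clC' : clear_left R h C by apply: clear_left_ccw.
by case; [apply: construction1_planar | apply: construction2_planar].
Qed.

(** * Area *)

(** The horizontal bound is relative to the root, which need not be central; the vertical one bounds
    the number of rows, wherever the root is, hence the strict inequality. *)
Definition fits h (G : drawing) (w k : nat) : Prop :=
  (forall u, u \in nodes h -> - w%:Z <= (G u).1 - (G [::]).1 <= w%:Z) /\
  (forall u v, u \in nodes h -> v \in nodes h -> (G u).2 - (G v).2 < k%:Z).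

Lemma fits_area h G w k : (0 < h)%N -> fits h G w k -> (area h G <= w.*2.+1 * k)%N.
Proof.
move=> h_gt0 [Gw Gk]; apply: leq_mul; last exact: size_coords Gk.
apply: size_coords => // u v u_h v_h.
by move: (Gw u u_h) (Gw v v_h); lia.
Qed.

(** The rows number [lo] below [r], [hi] above it, and one more for [r] itself. *)
Lemma fits_join h (r : point) A B C (w lo hi : nat) : (0 < h)%N ->
  let inside (D : drawing) := forall u, u \in nodes h ->
    - w%:Z <= (D u).1 - r.1 <= w%:Z /\ - lo%:Z <= (D u).2 - r.2 <= hi%:Z in
  inside A -> inside B -> inside C -> fits h.+1 (join r A B C) w (lo + hi).+1.
Proof.
move=> h_gt0 inside inA inB inC.
have inG u : u \in nodes h.+1 -> - w%:Z <= (join r A B C u).1 - r.1 <= w%:Z /\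
    - lo%:Z <= (join r A B C u).2 - r.2 <= hi%:Z.
  case: u => [_|i u]; first by rewrite !subrr; split; lia.
  rewrite mem_nodes ltnS -mem_nodes.
  by elim/forall_child: i => i E u_h; rewrite /= E; [apply: inA|apply: inB|apply: inC].
split=> [u /inG[]//|u v /inG[_ u_y] /inG[_ v_y]].
by move: u_y v_y; lia.
Qed.

(** After a quarter turn the half-width is measured vertically and the height horizontally. As
    [fits] is insensitive to reflections, swapping the axes expresses this for both turns. *)
Definition transpose (G : drawing) : drawing := fun u => ((G u).2, (G u).1).

Lemma fits_translate h G w k v : fits h G w k -> fits h (translate v G) w k.
Proof.
move=> [Gw Gk]; split=> [u u_h|u u' u_h u'_h] /=.
  by move: (Gw u u_h); lia.
by move: (Gk u u' u_h u'_h); lia.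
Qed.

Lemma fits_cw h G w k v :
  fits h G w k -> fits h (transpose (translate v (rotate_cw G))) w k.
Proof.
move=> [Gw Gk]; split=> [u u_h|u u' u_h u'_h] /=.
  by move: (Gw u u_h); lia.
by move: (Gk u u' u_h u'_h); lia.
Qed.

Lemma fits_ccw h G w k v :
  fits h G w k -> fits h (transpose (translate v (rotate_ccw G))) w k.
Proof.
move=> [Gw Gk]; split=> [u u_h|u u' u_h u'_h] /=.
  by move: (Gw u u_h); lia.
by move: (Gk u' u u'_h u_h); lia.
Qed.

Lemma extremal_nodes h D : (0 < h)%N ->
  [/\ exists2 u, u \in nodes h & (D u).1 = leftmost h D,
      exists2 u, u \in nodes h & (D u).1 = rightmost h D,
      exists2 u, u \in nodes h & (D u).2 = lowest h D &
      exists2 u, u \in nodes h & (D u).2 = topmost h D].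
Proof.
move=> h_gt0; split.
- exact: (cminP (fun u => (D u).1) h_gt0).2.
- exact: (cmaxP (fun u => (D u).1) h_gt0).2.
- exact: (cminP (fun u => (D u).2) h_gt0).2.
- exact: (cmaxP (fun u => (D u).2) h_gt0).2.
Qed.

(** Each side subdrawing adds [k] columns beyond those of [A]. Above [r] only the side ones rise, by
    [w]; below it [A] takes [kA] rows beside their [w]. *)
Lemma construction1_fits h r A B C (wA kA w k : nat) : (0 < h)%N ->
  construction1 h r A B C -> fits h A wA kA ->
  fits h (transpose B) w k -> fits h (transpose C) w k ->
  fits h.+1 (join r A B C) (wA + k) (maxn kA w + w).+1.
Proof.
move=> h_gt0 [rA tA rB rtB rC lC] [Aw Ak] [Bw Bk] [Cw Ck].
have [[a a_h Ea] [a' a'_h Ea'] _ [t t_h Et]] := extremal_nodes A h_gt0.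
have [_ [b b_h Eb] _ _] := extremal_nodes B h_gt0.
have [[c c_h Ec] _ _ _] := extremal_nodes C h_gt0.
rewrite tA in Et; rewrite rtB in Eb; rewrite lC in Ec.
rewrite rA in Aw; rewrite /= rB in Bw; rewrite /= rC in Cw.
have wa := Aw a a_h; have wa' := Aw a' a'_h.
apply: fits_join => // u u_h; have := node_box _ h_gt0 u_h.
- by move=> /(_ A); move: (Aw u u_h) (Ak t u t_h u_h); split; lia.
- by move=> /(_ B); move: (Bw u u_h) (Bk b u b_h u_h) => /=; split; lia.
- by move=> /(_ C); move: (Cw u u_h) (Ck u c u_h c_h) => /=; split; lia.
Qed.

(** The side subdrawings start next to the column of [r] and reach [w] rows above and below it; [A]
    then takes [kA] further rows underneath. *)
Lemma construction2_fits h r A B C (wA kA w k : nat) : (0 < h)%N ->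
  construction2 h r A B C -> fits h A wA kA ->
  fits h (transpose B) w k -> fits h (transpose C) w k ->
  fits h.+1 (join r A B C) (maxn wA k) (w + kA + w).+1.
Proof.
move=> h_gt0 [rB rtB rC lC rA tA] [Aw Ak] [Bw Bk] [Cw Ck].
have [_ _ _ [t t_h Et]] := extremal_nodes A h_gt0.
have [_ [b b_h Eb] [b' b'_h Eb'] _] := extremal_nodes B h_gt0.
have [[c c_h Ec] _ [c' c'_h Ec'] _] := extremal_nodes C h_gt0.
rewrite tA in Et; rewrite rtB in Eb; rewrite lC in Ec.
rewrite rA in Aw; rewrite /= rB in Bw; rewrite /= rC in Cw.
have /= wb := Bw b' b'_h; have /= wc := Cw c' c'_h.
have root_h : [::] \in nodes h by rewrite mem_nodes.
have := node_box B h_gt0 root_h; have := node_box C h_gt0 root_h.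
move=> boxC boxB.
apply: fits_join => // u u_h; have := node_box _ h_gt0 u_h.
- by move=> /(_ A); move: (Aw u u_h) (Ak t u t_h u_h); split; lia.
- by move=> /(_ B); move: (Bw u u_h) (Bk b u b_h u_h) => /=; split; lia.
- by move=> /(_ C); move: (Cw u u_h) (Ck u c u_h c_h) => /=; split; lia.
Qed.

(** * Drawings with prescribed dimensions *)

Lemma leftmost_translate v h G : (0 < h)%N ->
  leftmost h (translate v G) = leftmost h G + v.1.
Proof. exact: cmin_shift. Qed.

Lemma rightmost_translate v h G : (0 < h)%N ->
  rightmost h (translate v G) = rightmost h G + v.1.
Proof. exact: cmax_shift. Qed.

Lemma topmost_translate v h G : (0 < h)%N ->
  topmost h (translate v G) = topmost h G + v.2.
Proof. exact: cmax_shift. Qed.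

(* The strict bounds [w < x] and [k < y] absorb the summand 1 in the heights of
   both constructions, making the recursion homogeneous. *)
Definition drawable (R : realFieldType) h (x y : R) : Prop :=
  exists G w k, [/\ constructible12 h G, fits h G w k, w.+1%:R <= x & k.+1%:R <= y].

Lemma drawable_leaf (R : realFieldType) (x y : R) : 1 <= x -> 2 <= y -> drawable 1 x y.
Proof.
move=> x1 y2; exists (fun=> (0, 0)), 0%N, 1%N; split=> //.
exact: constructible12_leaf.
Qed.

Lemma drawable_construction1 (R : realFieldType) h (xA yA x y x' y' : R) :
  drawable h xA yA -> drawable h x y ->
  xA + y <= x' -> yA + x <= y' -> x + x <= y' -> drawable h.+1 x' y'.
Proof.
move=> [Ga [wA [kA [Ga12 GaF wA_x kA_y]]]] [G [w [k [G12 GF w_x k_y]]]] x'_ge y'_ge y'_ge'.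
have h_gt0 := constructible12_gt0 G12.
(* The root is put at the origin, and the shifts solve the alignment equations. The opposite signs
   of [(G [::]).1] in [B] and [C] come from the opposite turns. *)
pose A := translate (- (Ga [::]).1, - topmost h Ga - 1) Ga.
pose B := translate (leftmost h A - 1 - rightmost h (rotate_cw G), (G [::]).1)
  (rotate_cw G).
pose C := translate (rightmost h A + 1 - leftmost h (rotate_ccw G), - (G [::]).1)
  (rotate_ccw G).
have A_top : topmost h A = -1 by rewrite topmost_translate //=; lia.
have B_right : rightmost h B = leftmost h A - 1.
  by rewrite rightmost_translate //=; lia.
have C_left : leftmost h C = rightmost h A + 1.
  by rewrite leftmost_translate //=; lia.
have cABC : construction1 h (0, 0) A B C by split=> //=; lia.
exists (join (0, 0) A B C), (wA + k)%N, (maxn kA w + w).+1; split.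
- by apply: (constructible12_step Ga12 G12 G12); left.
- by apply: (construction1_fits h_gt0 cABC);
    [apply: fits_translate|apply: fits_cw|apply: fits_ccw].
- by move: wA_x k_y; rewrite -!natr1 natrD; lra.
- move: kA_y w_x; rewrite -!natr1 natrD; case: leqP => _; lra.
Qed.

Lemma drawable_construction2 (R : realFieldType) h (xA yA x y x' y' : R) :
  drawable h xA yA -> drawable h x y ->
  xA <= x' -> y <= x' -> x + yA + x <= y' -> drawable h.+1 x' y'.
Proof.
move=> [Ga [wA [kA [Ga12 GaF wA_x kA_y]]]] [G [w [k [G12 GF w_x k_y]]]] x'_ge x'_ge' y'_ge.
have h_gt0 := constructible12_gt0 G12.
pose B := translate (- 1 - rightmost h (rotate_cw G), (G [::]).1)
  (rotate_cw G).
pose C := translate (1 - leftmost h (rotate_ccw G), - (G [::]).1)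
  (rotate_ccw G).
(* [A] comes last because its height is dictated by the lowest rows of [B] and [C]. *)
pose A := translate (- (Ga [::]).1, Num.min (lowest h B) (lowest h C) - 1 - topmost h Ga) Ga.
have A_top : topmost h A = Num.min (lowest h B) (lowest h C) - 1.
  by rewrite topmost_translate //=; lia.
have B_right : rightmost h B = -1.
  by rewrite rightmost_translate //=; lia.
have C_left : leftmost h C = 1.
  by rewrite leftmost_translate //=; lia.
have cABC : construction2 h (0, 0) A B C by split=> //=; lia.
exists (join (0, 0) A B C), (maxn wA k), (w + kA + w).+1; split.
- by apply: (constructible12_step Ga12 G12 G12); right.
- by apply: (construction2_fits h_gt0 cABC);
    [apply: fits_translate|apply: fits_cw|apply: fits_ccw].
- move: wA_x k_y; rewrite -!natr1; case: leqP => _; lra.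
- by move: kA_y w_x; rewrite -!natr1 !natrD; lra.
Qed.

(** The three lines are X, Y and Z. The coefficients solve the recursion with equality except where
    [a ^+ 3 >= a ^+ 2 + a + 1] leaves room: the half-width of Z requires exactly this, and the
    height of X requires [2 * a ^+ 2 + 2 * a + 1 <= a ^+ 4], which follows from it. *)
Lemma three_families (R : realFieldType) (a : R) h : a = 13 / 7 ->
  [/\ drawable h.+1 (a ^+ 2 * a ^+ h) (a ^+ 3 * a ^+ h),
      drawable h.+1 ((a + a ^+ 2) * a ^+ h) ((a + a ^+ 2) * a ^+ h) &
      drawable h.+1 (a ^+ 3 * a ^+ h) ((2 * a + 1) * a ^+ h)].
Proof.
move=> Ea; have a2 : a ^+ 2 = 169 / 49 by rewrite Ea; field.
have a3 : a ^+ 3 = 2197 / 343 by rewrite Ea; field.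
rewrite a2 a3; elim: h => [|h [X Y Z]].
  by rewrite expr0; split; apply: drawable_leaf; lra.
have : 0 <= a ^+ h by apply: exprn_ge0; rewrite Ea; lra.
(* With [a] numeric and its power generalized to a nonnegative [g], all remaining inequalities are
   linear. *)
rewrite exprS; move: (a ^+ h) X Y Z; rewrite Ea => g X Y Z g_ge0.
split.
- by apply: (drawable_construction2 Z X); lra.
- by apply: (drawable_construction1 X X); lra.
- by apply: (drawable_construction1 Y X); lra.
Qed.

(** * The exponent of the area *)

Lemma leq_size_nodes h : (3 ^ h <= size (nodes h.+1))%N.
Proof. by rewrite size_nodes leq_divRL // expnS; have := expn_gt0 3 h; lia. Qed.

(** One more level multiplies the area bound by the left side, and the third power of the node count
    by the logarithmic scale of base 3 gives the right side. *)
Lemma sqr_le_powR (R : realType) :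
  (13 / 7 : R) ^+ 2 <= 3 `^ (1149 / 1000).
Proof.
apply: (@le_trans _ _ (3 `^ (8 / 7))); last by apply: ler_powR; lra.
(* The seventh power removes the real exponent and leaves the rational inequality between
   [(13 / 7) ^+ 14] and [3 ^+ 8]. *)
rewrite -(ler_pXn2r (n := 7)) // ?nnegrE ?powR_ge0 ?exprn_ge0 ?divr_ge0 ?ler0n //.
have -> : (3 `^ (8 / 7)) ^+ 7 = 3 ^+ 8 :> R.
  by rewrite -powR_mulrn ?powR_ge0 // -powRrM divfK ?pnatr_eq0 // powR_mulrn.
by rewrite !exprS !expr0; lra.
Qed.

Theorem theorem3 (R : realType) :
  exists C : R, 0 < C /\
    forall h : nat, (0 < h)%N ->
      exists G : drawing, drawing12 R h G /\
        (area h G)%:R <= C * (size (nodes h))%:R `^ (1149%:R / 1000%:R).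
Proof.
pose a : R := 13 / 7; have a_gt0 : 0 < a by rewrite /a; lra.
(* Family X has half-width below [a ^+ 2 * a ^+ h] and height below [a ^+ 3 * a ^+ h] at level
   [h.+1]; the factor 2 passes from half-width to width. *)
exists (2 * a ^+ 5); split; first by rewrite mulr_gt0 ?exprn_gt0.
case=> // h _; have [[G [w [k [G12 GF w_le k_le]]]] _ _] := @three_families R a h erefl.
exists G; split; first by split=> //; case: (constructible12_planar R G12).
have area_le := fits_area (ltn0Sn h) GF.
apply: (@le_trans _ _ (2 * a ^+ 5 * (a ^+ 2) ^+ h)).
  apply: (@le_trans _ _ ((2 * w.+1)%N%:R * k.+1%:R)).
    by rewrite -natrM ler_nat; apply: leq_trans area_le _; apply: leq_mul; lia.
  have -> : 2 * a ^+ 5 * (a ^+ 2) ^+ h = 2 * (a ^+ 2 * a ^+ h) * (a ^+ 3 * a ^+ h).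
    by rewrite -exprM mul2n -addnn exprD; ring.
  by rewrite natrM; apply: ler_pM; rewrite ?mulr_ge0 ?ler0n //; apply: ler_wpM2l.
apply: ler_wpM2l; first by rewrite mulr_ge0 ?exprn_ge0 ?ltW.
apply: (@le_trans _ _ ((3 `^ (1149 / 1000)) ^+ h)).
  by apply: lerXn2r (sqr_le_powR R); rewrite nnegrE ?powR_ge0 // exprn_ge0 ?ltW.
(* The exponents are exchanged, so that the base becomes [3 ^+ h], which is at most the number of
   nodes. *)
rewrite -powR_mulrn ?powR_ge0 // -powRrM mulrC powRrM powR_mulrn //.
apply: ge0_ler_powR; rewrite ?nnegrE ?exprn_ge0 ?ler0n //; first lra.
by rewrite -natrX ler_nat leq_size_nodes.
Qed.
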